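(* Let $I=(-1,1)$, let $e_k(x)=\sin(\frac{k\pi}2(x+1))$ for $k\in\mathbb{N}^*$, $x\in I$, and let $P$ be the orthogonal projection of $L^2_{\mathbb{C}}(I)$ onto the closure of $\mathrm{Span}(\{e_{4l+1}:l\in\mathbb{N}\})$. For $n\in\mathbb{N}$ define, for a.e. $z\in(-2,2)$, $$K_n(z):=\frac{\sin\left[\pi\left(n+\frac12\right)(z+1)\right]\,\sin\left[\pi(n+1)(z+1)\right]}{\sin[\pi(z+1)]} .$$ Then for every $u\in L^2_{\mathbb{C}}(I)$ $$Pu=\lim_{n\to\infty}K_n*\tfrac12\,[u+u\circ(-\mathrm{id}_I)] ,$$ where $(K_n*w)(x)=\int_{-1}^1K_n(x-y)\,w(y)\,dy$ denotes the integral convolution on $I$, and the limit is taken in $L^2_{\mathbb{C}}(I)$.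
   Context: $\mathbb{N}=\{0,1,2,\dots\}$, $\mathbb{N}^*=\{1,2,\dots\}$. $(u\circ(-\mathrm{id}_I))(x)=u(-x)$. The functions $(e_k)_{k\in\mathbb{N}^*}$ form a Hilbert basis (complete orthonormal system) of $L^2_{\mathbb{C}}(I)$. *)

(* Defs.v *)
(* MathComp-Analysis; the complex numbers are R[i], for R : realType. *)
From HB Require Import structures.
From mathcomp Require Import all_boot all_order all_algebra.
From mathcomp Require Import all_classical all_reals all_analysis.
From mathcomp Require Export complex.
Import numFieldNormedType.Exports.

Set Implicit Arguments.
Unset Strict Implicit.
Unset Printing Implicit Defensive.

Import Order.TTheory GRing.Theory Num.Theory.

Local Open Scope classical_set_scope.
Local Open Scope ring_scope.
Local Open Scope complex_scope.

(* Elements of L^2_C(I), I = (-1, 1), are represented by functions on R of which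
   only the values on I matter: measurability, norm and integral look at I only.
   Measurability is Borel; every class of L^2(I) has a Borel representative. *)

Definition itvI (R : realType) : set R := `]-1, 1[.

Definition L2norm (R : realType) (f : R -> R[i]) : \bar R :=
  'N[lebesgue_measure]_2%:E[(fun x => (ComplexField.Normc.normc (f x))%:E)
                              \_ (@itvI R)]%E.

Definition inL2 (R : realType) (f : R -> R[i]) : Prop :=
  [/\ measurable_fun (@itvI R) (fun x => complex.Re (f x)),
      measurable_fun (@itvI R) (fun x => complex.Im (f x)) &
      (L2norm f < +oo)%E].

Definition cintegral (R : realType) (f : R -> R[i]) : R[i] :=
  (\int[lebesgue_measure]_(x in @itvI R) complex.Re (f x))
  +i* (\int[lebesgue_measure]_(x in @itvI R) complex.Im (f x)).

Definition L2inner (R : realType) (f g : R -> R[i]) : R[i] :=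
  cintegral (fun x => f x * (g x)^*).

Definition L2cvg (R : realType) (v : nat -> R -> R[i]) (f : R -> R[i]) : Prop :=
  [/\ forall n, inL2 (v n), inL2 f &
      (fun n => L2norm (v n \- f)) @ \oo --> 0%E].

Definition cspan (R : realType) (A : set (R -> R[i])) : set (R -> R[i]) :=
  [set f | exists (m : nat) (c : 'I_m -> R[i]) (g : 'I_m -> R -> R[i]),
     (forall i, A (g i)) /\ forall x, f x = \sum_(i < m) c i * g i x].

(* The closure in L^2_C(I); among functions satisfying inL2 it is stable
   under a.e. equality on I. *)
Definition L2closure (R : realType) (A : set (R -> R[i])) : set (R -> R[i]) :=
  [set f | inL2 f /\
     forall eps : R, 0 < eps ->
       exists g, [/\ A g, inL2 g & (L2norm (f \- g)%R < eps%:E)%E]].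

Definition is_orthogonal_projection (R : realType) (M : set (R -> R[i]))
    (u p : R -> R[i]) : Prop :=
  M p /\ forall m, M m -> L2inner (u \- p) m = 0.

(* For M a closed subspace of L^2_C(I) and u in L^2_C(I), the projection exists
   and is unique up to a.e. equality; xget picks a representative. *)
Definition orthogonal_projection (R : realType) (M : set (R -> R[i]))
    (u : R -> R[i]) : R -> R[i] :=
  xget (fun=> 0) [set p | is_orthogonal_projection M u p].

Definition esin (R : realType) (k : nat) (x : R) : R[i] :=
  (sin (k%:R * pi / 2 * (x + 1)))%:C.

(* On (-2, 2) the denominator vanishes only at z = -1, 0, 1, where the value is
   irrelevant (here it is 0). *)
Definition Kker (R : realType) (n : nat) (z : R) : R :=
  sin (pi * (n%:R + 1 / 2) * (z + 1)) * sin (pi * (n%:R + 1) * (z + 1))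
  / sin (pi * (z + 1)).

Definition convol (R : realType) (K : R -> R) (w : R -> R[i]) (x : R) : R[i] :=
  cintegral (fun y => (K (x - y))%:C * w y).

(* Main.v *)
Require Import Defs.
From mathcomp Require Import all_boot all_order all_algebra.
From mathcomp Require Import all_classical all_reals all_analysis.
From mathcomp Require Import measurable_realfun.
From mathcomp Require Import ring lra.
Import numFieldNormedType.Exports.

(* The kernel telescopes, [K_n(z) = \sum_(l <= n) cos ((4l+1) pi z / 2)], and
   [e_(4l+1)(x) = cos ((4l+1) pi x / 2)] is even, so convolving [K_n] with the even
   part of [u] gives exactly the partial sum [\sum_(l <= n) <u, e_(4l+1)> e_(4l+1)].
   The projection [p] exists by Riesz-Fischer, and [u - p] is orthogonal to every
   [e_(4l+1)], so these are also the partial sums of [p].  As [p] lies in the closed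
   span, their best-approximation property makes them converge to [p].
   Real and imaginary parts are treated separately in real L^2. *)

Set Implicit Arguments.
Unset Strict Implicit.
Unset Printing Implicit Defensive.

Import Order.TTheory GRing.Theory Num.Theory.

Local Open Scope classical_set_scope.
Local Open Scope ring_scope.

(** * Square-integrable real functions and their bilinear form *)

Section square_integrable.
Context d (T : measurableType d) (R : realType).
Variables (mu : {measure set T -> \bar R}) (D : set T).
Implicit Types f g h : T -> R.

(** The even part of [u] enters through the addition formula: each [cos (freq R l * (x - y))] splits
    into a product of cosines and a product of sines. An even function integrates to zero against
    the sine, and the even part has the same cosine coefficient as [u] itself. The cosine form of
    the kernel is only available where [sin (pi * z)] is nonzero. For a fixed [x] in I this excludes
    at most three values of [y], a null set. [orthogonal_projection] picks an unspecified
    representative. Existence is therefore proved first, and afterwards only the two defining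
    properties of a projection are used: the function built by Riesz-Fischer cannot be assumed to be
    the one picked. Functions are not quotiented by a.e. equality, so estimates are phrased with the
    squared norm [ip f f]. A weighted Young inequality, linear in squared norms, takes the place of
    Cauchy-Schwarz, its weight being tuned at each use. *)

Definition sqint f : Prop :=
  measurable_fun D f /\ mu.-integrable D (EFin \o (fun x => f x ^+ 2)).

Definition ip f g : R := \int[mu]_(x in D) (f x * g x).

Hypothesis mD : measurable D.

(** Dominated by [f ^+ 2 + g ^+ 2] pointwise. *)
Lemma sqintM f g : sqint f -> sqint g ->
  mu.-integrable D (EFin \o (fun x => f x * g x)).
Proof.
move=> [mf f2] [mg g2].
apply: (@le_integrable _ _ _ mu D mD _
    (fun x => (f x ^+ 2)%:E + (g x ^+ 2)%:E)%E).
- by apply/measurable_EFinP; exact: measurable_funM.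
- move=> x Dx /=; rewrite lee_fin.
  rewrite [leRHS]ger0_norm ?addr_ge0 ?sqr_ge0//.
  by rewrite ler_norml; apply/andP; split; nra.
- exact: integrableD.
Qed.

Lemma sqint0 : sqint (cst 0).
Proof.
split; first exact: measurable_cst.
by rewrite (_ : EFin \o _ = cst 0%E) ?integrable0//; apply/funext => x /=;
  rewrite expr0n.
Qed.

Lemma sqintZ (c : R) f : sqint f -> sqint (fun x => c * f x).
Proof.
move=> [mf f2]; split; first exact: measurable_funM.
rewrite (_ : EFin \o _ = (fun x => (c ^+ 2)%:E * (f x ^+ 2)%:E)%E).
  exact: integrableZl.
by apply/funext => x /=; rewrite exprMn EFinM.
Qed.

Lemma sqintD f g : sqint f -> sqint g -> sqint (fun x => f x + g x).
Proof.
move=> sf sg; have fg := sqintM sf sg; case: sf sg => [mf f2] [mg g2].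
split; first exact: measurable_funD.
rewrite (_ : EFin \o _ = (fun x => ((f x ^+ 2)%:E + (g x ^+ 2)%:E)
   + 2%:E * (f x * g x)%:E)%E).
  by apply: integrableD => //; [exact: integrableD | exact: integrableZl].
by apply/funext => x /=; rewrite -EFinM -!EFinD; congr EFin; ring.
Qed.

Lemma sqintB f g : sqint f -> sqint g -> sqint (fun x => f x - g x).
Proof.
move=> sf /(sqintZ (-1)) sg; have := sqintD sf sg.
by under eq_fun do rewrite mulN1r.
Qed.

Lemma sqint_sum (I : Type) (s : seq I) (F : I -> T -> R) :
  (forall i, sqint (F i)) -> sqint (fun x => \sum_(i <- s) F i x).
Proof.
move=> sF; elim: s => [|i s ih].
  by under eq_fun do rewrite big_nil; exact: sqint0.
by under eq_fun do rewrite big_cons; exact: sqintD.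
Qed.

Lemma ipC f g : ip f g = ip g f.
Proof. by rewrite /ip; under eq_Rintegral do rewrite mulrC. Qed.

Lemma ipDl f g h : sqint f -> sqint g -> sqint h ->
  ip (fun x => f x + g x) h = ip f h + ip g h.
Proof.
move=> sf sg sh; rewrite /ip; under eq_Rintegral do rewrite mulrDl.
by rewrite RintegralD//; exact: sqintM.
Qed.

Lemma ipZl (c : R) f g : sqint f -> sqint g ->
  ip (fun x => c * f x) g = c * ip f g.
Proof.
move=> sf sg; rewrite /ip; under eq_Rintegral do rewrite -mulrA.
by rewrite RintegralZl//; exact: sqintM.
Qed.

Lemma ipBl f g h : sqint f -> sqint g -> sqint h ->
  ip (fun x => f x - g x) h = ip f h - ip g h.
Proof.
move=> sf sg sh; rewrite /ip; under eq_Rintegral do rewrite mulrBl.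
by rewrite RintegralB//; exact: sqintM.
Qed.

Lemma ipDr f g h : sqint f -> sqint g -> sqint h ->
  ip h (fun x => f x + g x) = ip h f + ip h g.
Proof. by move=> sf sg sh; rewrite ipC ipDl// ipC [ip g h]ipC. Qed.

Lemma ipBr f g h : sqint f -> sqint g -> sqint h ->
  ip h (fun x => f x - g x) = ip h f - ip h g.
Proof. by move=> sf sg sh; rewrite ipC ipBl// ipC [ip g h]ipC. Qed.

Lemma ipZr (c : R) f g : sqint f -> sqint g ->
  ip f (fun x => c * g x) = c * ip f g.
Proof. by move=> sf sg; rewrite ipC ipZl// ipC. Qed.

Lemma ip0l f : ip (cst 0) f = 0.
Proof.
by rewrite /ip; under eq_Rintegral do rewrite /= mul0r;
  rewrite Rintegral_cst// mul0r.
Qed.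

Lemma ip_suml (I : Type) (s : seq I) (F : I -> T -> R) f :
  (forall i, sqint (F i)) -> sqint f ->
  ip (fun x => \sum_(i <- s) F i x) f = \sum_(i <- s) ip (F i) f.
Proof.
move=> sF sf; elim: s => [|i s ih].
  have -> : (fun x => \sum_(i <- [::]) F i x) = cst 0.
    by apply/funext => x; rewrite big_nil.
  by rewrite big_nil ip0l.
have -> : (fun x => \sum_(i <- i :: s) F i x) =
    (fun x => F i x + \sum_(i <- s) F i x).
  by apply/funext => x; rewrite big_cons.
by rewrite big_cons ipDl ?ih//; exact: sqint_sum.
Qed.

Lemma ip_ge0 f : 0 <= ip f f.
Proof. by apply: Rintegral_ge0 => x _; rewrite -expr2 sqr_ge0. Qed.

Lemma integral_sqrE f : sqint f ->
  (\int[mu]_(x in D) (f x ^+ 2)%:E)%E = (ip f f)%:E.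
Proof.
move=> [mf f2]; rewrite /ip /Rintegral fineK//.
exact: integrable_fin_num.
Qed.

Lemma sqintP f : sqint f <->
  measurable_fun D f /\ (\int[mu]_(x in D) (f x ^+ 2)%:E < +oo)%E.
Proof.
split=> [sf|[mf ifoo]].
  by split; [case: sf | rewrite integral_sqrE// ltry].
split => //; apply/integrableP; split.
  by apply/measurable_EFinP; exact: measurable_funX.
move: ifoo; under [X in (X < _)%E -> _]eq_integral do
  rewrite -[(_ ^+ 2)%:E]gee0_abs ?lee_fin ?sqr_ge0//.
by [].
Qed.

Lemma ip_sqrD f g : sqint f -> sqint g ->
  ip (fun x => f x + g x) (fun x => f x + g x) =
  ip f f + ip g g + 2 * ip f g.
Proof.
move=> sf sg; have sfg := sqintD sf sg.
by rewrite ipDl// !ipDr// [ip g f]ipC; ring.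
Qed.

(** Expand the nonnegative square of [t * f + s * g] and divide by [t]; the signs [s = 1] and
    [s = -1] together give the absolute value. *)
Lemma ip_young (t : R) f g : 0 < t -> sqint f -> sqint g ->
  2 * `|ip f g| <= t * ip f f + t^-1 * ip g g.
Proof.
move=> t0 sf sg.
have key s : s ^+ 2 = 1 -> 0 <= t * ip f f + t^-1 * ip g g + 2 * s * ip f g.
  move=> s1; have := ip_ge0 (fun x => t * f x + s * g x).
  rewrite ip_sqrD ?ipZl ?ipZr//; do ?exact: sqintZ.
  rewrite -(pmulr_rge0 _ (_ : 0 < t^-1)) ?invr_gt0//.
  congr (0 <= _).
  transitivity (t^-1 * t * t * ip f f + t^-1 * s ^+ 2 * ip g g
    + 2 * (t^-1 * t) * s * ip f g); first by ring.
  by rewrite s1 mulVf ?gt_eqF//; ring.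
have := key 1 (expr1n _ _); have := key (-1) (sqrr_sign _ 1).
by case: (ger0P (ip f g)); lra.
Qed.

End square_integrable.

Lemma cvg_summable_increments (R : realType) (u : R^nat) :
  (\sum_(0 <= k <oo) `|u k.+1 - u k|%:E < +oo)%E -> cvgn u.
Proof.
move=> sumoo.
have d0 k : (0 <= `|u k.+1 - u k|%:E)%E by rewrite lee_fin.
have sum0 := nneseries_ge0 (fun k (_ : (0 <= k)%N) (_ : true) => d0 k).
have : cvgn [normed series (fun k => u k.+1 - u k)].
  apply: nondecreasing_is_cvgn.
    apply: nondecreasing_series => k _ _; exact: normr_ge0.
  exists (fine (\sum_(0 <= k <oo) `|u k.+1 - u k|%:E)) => _ [n _ <-].
  rewrite -lee_fin fineK; last by rewrite ge0_fin_numE.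
  by rewrite /= -sumEFin; apply: nneseries_lim_ge.
move/normed_cvg; rewrite -/(telescope u) => cs.
have -> : u = (fun n => u 0%N + series (telescope u) n).
  apply/funext => n; rewrite /series/= /telescope.
  by rewrite telescope_sumr// addrC subrK.
by apply: is_cvgD => //; exact: is_cvg_cst.
Qed.

(** * Completeness of L^2 over a set of finite measure *)

Section completeness.
Context d (T : measurableType d) (R : realType).
Variables (mu : {measure set T -> \bar R}) (D : set T).
Hypothesis mD : measurable D.
Hypothesis muD : (mu D < +oo)%E.
Implicit Types f g h : T -> R.

Local Notation sqint := (sqint mu D).
Local Notation ip := (ip mu D).

Lemma sqint_bounded f M : measurable_fun D f ->
  (forall x, D x -> `|f x| <= M) -> sqint f.
Proof.
move=> mf fM; split => //; apply: measurable_bounded_integrable => //.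
  exact: measurable_funX.
exists (M ^+ 2); split; first exact: num_real.
move=> N MN x Dx /=; rewrite normrX (le_trans _ (ltW MN))//.
by rewrite lerXn2r ?nnegrE// ?(le_trans _ (fM _ Dx))//; exact: fM.
Qed.

(** Young's inequality against the constant 1, whose squared norm is the measure of [D]. It turns
    L^2 closeness into L^1 closeness. *)
Lemma integral_norm_le (t : R) f : 0 < t -> sqint f ->
  (\int[mu]_(x in D) `|f x|%:E <=
     ((t * ip f f + t^-1 * fine (mu D)) / 2)%:E)%E.
Proof.
move=> t0 sf; have [mf f2] := sf.
have sn : sqint (fun x => `|f x|).
  split; first exact: measurableT_comp.
  by under [X in EFin \o X]eq_fun do rewrite real_normK ?num_real//.
have s1 : sqint (cst 1) by apply: (@sqint_bounded _ 1) => //= *; rewrite normr1.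
have := ip_young mD t0 sn s1.
have -> : ip (fun x => `|f x|) (fun x => `|f x|) = ip f f.
  by apply: eq_Rintegral => x _; rewrite -normrM ger0_norm// -expr2 sqr_ge0.
have -> : ip (cst 1) (cst 1) = fine (mu D).
  by rewrite /ip/= mulr1 Rintegral_cst// mul1r.
move=> H; have := sqintM mD sn s1.
under [X in EFin \o X]eq_fun do rewrite mulr1.
move=> i1; rewrite -(fineK (integrable_fin_num mD i1)) lee_fin.
rewrite ler_pdivlMr// mulrC; apply: le_trans H.
rewrite ler_pM2l// /ip; under [in leRHS]eq_Rintegral do rewrite mulr1.
exact: ler_norm.
Qed.

(* A subsequence [s] with [\sum_k |s_{k+1} - s_k|] integrable converges almost
   everywhere, and Fatou's lemma identifies its limit as the limit in L^2. *)
Lemma sqint_complete (f : nat -> T -> R) (N : nat -> nat) :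
  (forall n, sqint (f n)) ->
  (forall k m n, (N k <= m)%N -> (N k <= n)%N ->
    ip (fun x => f m x - f n x) (fun x => f m x - f n x) <= 4^-1 ^+ k) ->
  exists g, sqint g /\ forall k n, (N k <= n)%N ->
    ip (fun x => g x - f n x) (fun x => g x - f n x) <= 4^-1 ^+ k.
Proof.
(* Summing the [N j] gives nondecreasing indices that still dominate each [N k]. *)
move=> sf Nf; pose M k := (\sum_(j < k.+1) N j)%N.
have NM k : (N k <= M k)%N by rewrite /M big_ord_recr leq_addl.
have Mnd : {homo M : m n / (m <= n)%N}.
  apply: homo_leq => //; first exact: leq_trans.
  by move=> k; rewrite /M [leqRHS]big_ord_recr leq_addr.
pose s k := f (M k).
have ss k : sqint (s k) by exact: sf.
have sdiff m k : sqint (fun x => f m x - f k x) by exact: sqintB.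
have step k : (\int[mu]_(x in D) `|s k.+1 x - s k x|%:E <=
    ((1 + fine (mu D)) / (2 ^ (k + 1))%:R)%:E)%E.
  (* This weight balances the two terms: [2 ^+ k * 4^-1 ^+ k] and the inverse weight are both
     [2^-1 ^+ k], which is summable. *)
  have t0 : 0 < 2 ^+ k :> R by rewrite exprn_gt0.
  apply: le_trans (integral_norm_le t0 (sdiff _ _)) _; rewrite lee_fin.
  have := Nf k (M k.+1) (M k) (leq_trans (NM k) (Mnd _ _ (leqnSn k))) (NM k).
  rewrite -(ler_pM2l t0) => H.
  rewrite addn1 expnSr natrM natrX invfM mulrA ler_wpM2r ?invr_ge0//.
  rewrite [leRHS]mulrDl mul1r [leRHS]addrC [leLHS]addrC mulrC lerD2l.
  apply: le_trans H _; rewrite -exprVn -exprMn.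
  by rewrite (_ : 2 * 4^-1 = 2^-1 :> R)//; lra.
pose G x := (\sum_(0 <= k <oo) `|s k.+1 x - s k x|%:E)%E.
have mstep k : measurable_fun D (fun x => `|s k.+1 x - s k x|%:E).
  apply/measurable_EFinP; apply: measurableT_comp => //.
  by case: (sdiff (M k.+1) (M k)).
have G0 x : (0 <= G x)%E by apply: nneseries_ge0 => *; rewrite lee_fin.
have iG : (\int[mu]_(x in D) G x < +oo)%E.
  rewrite integral_nneseries//.
  apply: (@le_lt_trans _ _ (1 + fine (mu D))%:E); last by rewrite ltry.
  apply: (@le_trans _ _ (\sum_(0 <= k <oo)
      ((1 + fine (mu D)) / (2 ^ (k + 1))%:R)%:E)%E).
    by apply: lee_nneseries => // k _ _; apply: integral_ge0 => x _;
      rewrite lee_fin.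
  have /cvg_lim -> // := @cvg_geometric_eseries_half R (1 + fine (mu D)) 0.
  by rewrite expr0 divr1.
have mG : measurable_fun D G.
  by apply: ge0_emeasurable_sum => // *; rewrite lee_fin.
have aecvg : {ae mu, forall x, D x -> cvgn (s ^~ x)}.
  have : mu.-integrable D G.
    apply/integrableP; split => //.
    by under eq_integral do rewrite gee0_abs//.
  move/(integrable_ae mD); apply: filterS => x /[apply] Gx.
  by apply: cvg_summable_increments; rewrite -/(G x) -ge0_fin_numE.
(* The upper limit is measurable whether or not the sequence converges, and equals the pointwise
   limit wherever that exists. *)
pose g x := fine (limn_esup (fun k => (s k x)%:E)).
have gE x : cvgn (s ^~ x) -> s ^~ x @ \oo --> g x.
  move=> cs; rewrite /g.
  have /cvg_limn_einf_sup[_ ->] // : (s k x)%:E @[k --> \oo] --> (limn (s^~ x))%:E.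
  exact/cvg_EFin/cs/nearW.
have mg : measurable_fun D g.
  apply: measurableT_comp => //; apply: measurable_fun_limn_esup => k.
  by apply/measurable_EFinP; case: (ss k).
have bnd k n : (N k <= n)%N ->
    (\int[mu]_(x in D) ((g x - f n x) ^+ 2)%:E <= (4^-1 ^+ k)%:E)%E.
  move=> kn; pose v j x := ((s j x - f n x) ^+ 2)%:E.
  have mv j : measurable_fun D (v j).
    apply/measurable_EFinP; apply: measurable_funX.
    by case: (sdiff (M j) n).
  have v0 j x : D x -> (0 <= v j x)%E by rewrite lee_fin sqr_ge0.
  have -> : (\int[mu]_(x in D) ((g x - f n x) ^+ 2)%:E =
      \int[mu]_(x in D) limn_einf (v ^~ x))%E.
    apply: ge0_ae_eq_integral => //.
    - apply/measurable_EFinP; apply: measurable_funX.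
      by apply: measurable_funB => //; case: (sf n).
    - rewrite /limn_einf; apply: measurableT_comp => //.
      by apply: measurable_fun_limn_esup => j; exact: measurableT_comp.
    - by move=> x _; rewrite lee_fin sqr_ge0.
    - move=> x Dx; rewrite limn_einf_lim; apply: lime_ge.
        exact: is_cvg_einfs.
      by apply: nearW => j; apply: le_ereal_inf_tmp => _ [i _ <-]; exact: v0.
    apply: filterS aecvg => x /[apply] /gE gx.
    apply/esym/(cvg_limn_einf_sup _).1.
    apply: cvg_EFin; first exact: nearW.
    have dx : s j x - f n x @[j --> \oo] --> g x - f n x.
      by apply: cvgB => //; exact: cvg_cst.
    exact: (cvgM dx dx).
  apply: (le_trans (fatou mu mD mv v0)).
  rewrite limn_einf_lim; apply: lime_le; first exact: is_cvg_einfs.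
  near=> j.
  apply: (@le_trans _ _ (\int[mu]_(x in D) v j x)%E).
    by apply: ereal_inf_lbound; exists j => //=.
  rewrite /v integral_sqrE//; last exact: sdiff.
  rewrite lee_fin; apply: Nf => //.
  apply: (leq_trans (NM k)); apply: Mnd.
  by near: j; exists k.
(* The bound at [k = 0] makes [g - f (N 0)] square integrable; adding back [f (N 0)] gives [g]. *)
have sg : sqint g.
  have : sqint (fun x => g x - f (N 0%N) x).
    apply/(sqintP _ mD); split.
      by apply: measurable_funB => //; case: (sf (N 0%N)).
    by apply: (le_lt_trans (bnd 0%N _ (leqnn _))); rewrite ltry.
  move=> /(sqintD mD)/(_ (sf (N 0%N))).
  by under eq_fun do rewrite subrK.
exists g; split => // k n kn.
by rewrite -lee_fin -integral_sqrE//; [exact: bnd | exact: sqintB].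
Unshelve. all: by end_near. Qed.

End completeness.

(** The hypothesis is the shape of Young's inequality when one factor has squared norm at most
    [eps ^+ 2] and the weight is [eps] or its inverse. Applying it to [eps / (A + 1)] bounds the
    right side by [eps]. *)
Lemma small_norm_eq0 (R : realFieldType) (A r : R) : 0 <= A ->
  (forall eps, 0 < eps -> 2 * `|r| <= eps * A + eps) -> r = 0.
Proof.
move=> A0 H; apply/eqP; rewrite -normr_le0; apply/ler_addgt0Pl => eps eps0.
have A1 : 0 < A + 1 by lra.
have := H (eps / (A + 1)); rewrite divr_gt0// => /(_ isT).
rewrite -[X in _ <= _ + X]mulr1 -mulrDr divfK ?gt_eqF//; have := normr_ge0 r; lra.
Qed.

(** * Fourier partial sums for an orthonormal sequence *)

Section orthonormal_system.
Context d (T : measurableType d) (R : realType).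
Variables (mu : {measure set T -> \bar R}) (D : set T).
Hypothesis mD : measurable D.
Hypothesis muD : (mu D < +oo)%E.

Local Notation sqint := (sqint mu D).
Local Notation ip := (ip mu D).

Variable e : nat -> T -> R.
Hypothesis se : forall l, sqint (e l).
Hypothesis oe : forall k l, ip (e k) (e l) = (k == l)%:R.
Implicit Types (f g h : T -> R) (a b : nat -> R).

Definition psum a n (x : T) : R := \sum_(l < n) a l * e l x.

(** The real counterpart of [L2closure (cspan _)], with every finite combination normalised to a
    [psum] and the squared distance in place of the distance. *)
Definition clspan h : Prop := sqint h /\ forall eps, 0 < eps ->
  exists b m, ip (fun x => h x - psum b m x) (fun x => h x - psum b m x) < eps.

Lemma sqint_psum a n : sqint (psum a n).
Proof. by apply: sqint_sum => // l; exact: sqintZ. Qed.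

Lemma ip_psuml a n f : sqint f ->
  ip (psum a n) f = \sum_(l < n) a l * ip (e l) f.
Proof.
move=> sf; rewrite ip_suml//; last by move=> l; exact: sqintZ.
by apply: eq_bigr => l _; rewrite ipZl.
Qed.

Lemma ip_psum_e a n k : ip (psum a n) (e k) = if (k < n)%N then a k else 0.
Proof.
rewrite ip_psuml//; under eq_bigr do rewrite oe.
case: ltnP => [kn|nk].
  rewrite (bigD1 (Ordinal kn))//= eqxx mulr1 big1 ?addr0// => l lk.
  by rewrite (negbTE (_ : l != k :> nat)) ?mulr0.
by rewrite big1// => l _; rewrite ltn_eqF ?mulr0// (leq_trans (ltn_ord l)).
Qed.

Lemma ip_psum a n : ip (psum a n) (psum a n) = \sum_(l < n) a l ^+ 2.
Proof.
rewrite ip_psuml; last exact: sqint_psum.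
by apply: eq_bigr => l _; rewrite ipC ip_psum_e ltn_ord expr2.
Qed.

Lemma psumB a b n : (fun x => psum a n x - psum b n x) =
  psum (fun l => a l - b l) n.
Proof.
by apply/funext => x; rewrite /psum -sumrB; apply: eq_bigr => l _;
  rewrite mulrBl.
Qed.

(** Padding with zero coefficients makes sums of different lengths comparable. *)
Lemma psum_widen a m n : (m <= n)%N ->
  psum a m = psum (fun l => if (l < m)%N then a l else 0) n.
Proof.
move=> mn; apply/funext => x; rewrite /psum (big_ord_widen n (fun l => a l * e l x))//.
rewrite big_mkcond/=; apply: eq_bigr => l _.
by case: ifP => // _; rewrite mul0r.
Qed.

Lemma ip_psum_sub a m n : (m <= n)%N ->
  ip (fun x => psum a n x - psum a m x) (fun x => psum a n x - psum a m x) =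
  \sum_(l < n) a l ^+ 2 - \sum_(l < m) a l ^+ 2.
Proof.
move=> mn; rewrite (psum_widen _ mn) psumB ip_psum.
rewrite (big_ord_widen n (fun l => a l ^+ 2) mn) [X in _ - X]big_mkcond/= -sumrB.
apply: eq_bigr => l _; case: ifP => _; last by rewrite !subr0.
by rewrite !subrr expr0n.
Qed.

Section fourier_partial_sums.
Variable f : T -> R.
Hypothesis sf : sqint f.
Let c l := ip f (e l).

Lemma ip_residual_psum b n : ip (fun x => f x - psum c n x) (psum b n) = 0.
Proof.
rewrite ipBl//; [|exact: sqint_psum..].
rewrite ipC ip_psuml// [X in _ - X]ipC ip_psuml; last exact: sqint_psum.
rewrite -sumrB big1// => l _.
by rewrite ipC [ip (e l) _]ipC ip_psum_e ltn_ord subrr.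
Qed.

(** Pythagoras: the Fourier residual is orthogonal to the remaining difference, itself a [psum].
    Allowing [m <= n] lets one good approximation control all later partial sums. *)
Lemma ip_psum_best b m n : (m <= n)%N ->
  ip (fun x => f x - psum c n x) (fun x => f x - psum c n x) <=
  ip (fun x => f x - psum b m x) (fun x => f x - psum b m x).
Proof.
move=> mn; rewrite (psum_widen b mn); set b' := fun l => if _ then _ else _.
have -> : (fun x => f x - psum b' n x) =
    (fun x => (f x - psum c n x) + psum (fun l => c l - b' l) n x).
  by apply/funext => x; rewrite -psumB; ring.
rewrite [leRHS]ip_sqrD//; [|by apply: sqintB => //; exact: sqint_psum|exact: sqint_psum].
by rewrite ip_residual_psum mulr0 addr0 lerDl ip_ge0.
Qed.

Lemma bessel n : \sum_(l < n) c l ^+ 2 <= ip f f.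
Proof.
have {1 2}-> : f = (fun x => (f x - psum c n x) + psum c n x).
  by apply/funext => x; rewrite subrK.
rewrite ip_sqrD//; [|by apply: sqintB => //; exact: sqint_psum|exact: sqint_psum].
by rewrite ip_residual_psum mulr0 addr0 ip_psum lerDr ip_ge0.
Qed.

Lemma riesz_fischer : exists g, sqint g /\
  ip (fun x => g x - psum c n x) (fun x => g x - psum c n x) @[n --> \oo] --> 0.
Proof.
pose S n := \sum_(l < n) c l ^+ 2.
have cS : cvgn S.
  apply: nondecreasing_is_cvgn.
    apply/nondecreasing_seqP => n; rewrite /S big_ord_recr/= lerDl.
    exact: sqr_ge0.
  by exists (ip f f) => _ [n _ <-]; exact: bessel.
(* A Cauchy modulus for the numerical series, at the rate [4^-1 ^+ k] required by [sqint_complete];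
   squared distances of partial sums are exactly differences of [S]. *)
have /choice[N NP] : forall k, exists N, forall m n,
    (N <= m)%N -> (N <= n)%N -> `|S m - S n| <= 4^-1 ^+ k.
  move=> k.
  have e0 : 0 < 4^-1 ^+ k / 2 :> R by rewrite divr_gt0// exprn_gt0.
  move/cvgrPdist_le : cS => /(_ _ e0)[N _ NP]; exists N => m n Nm Nn.
  have := NP _ Nm; have := NP _ Nn => /= H1 H2.
  rewrite (_ : S m - S n = (limn S - S n) - (limn S - S m)); last by ring.
  by apply: (le_trans (ler_normB _ _)); rewrite [leRHS](splitr); exact: lerD.
have [|g [sg gN]] := @sqint_complete _ _ _ mu D mD muD (psum c) N
  (sqint_psum c); last first.
  exists g; split => //; apply/cvgrPdist_le => eps eps0.
  have : 4^-1 ^+ k @[k --> \oo] --> (0 : R).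
    by apply: cvg_expr; rewrite ger0_norm//; lra.
  move/cvgrPdist_le => /(_ _ eps0)[k _ /(_ k (leqnn k))/=].
  rewrite sub0r normrN ger0_norm ?exprn_ge0// => kle.
  near=> n.
  rewrite sub0r normrN ger0_norm ?ip_ge0//.
  apply: le_trans kle; apply: gN.
  by near: n; exists (N k).
move=> k m n Nm Nn; apply: le_trans (NP _ _ _ Nm Nn).
wlog nm : m n Nm Nn / (n <= m)%N => [H|].
  have [|/ltnW mn] := leqP n m; first exact: H.
  rewrite distrC; apply: le_trans (H _ _ Nn Nm mn).
  rewrite le_eqVlt; apply/orP; left; apply/eqP.
  by apply: eq_Rintegral => x _; ring.
by rewrite ip_psum_sub// ler_norm.
Unshelve. all: by end_near. Qed.

End fourier_partial_sums.

Lemma clspan_psum_cvg h : clspan h ->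
  ip (fun x => h x - psum (fun l => ip h (e l)) n x)
     (fun x => h x - psum (fun l => ip h (e l)) n x) @[n --> \oo] --> 0.
Proof.
move=> [sh H]; apply/cvgrPdist_le => eps eps0.
have [b [m bm]] := H _ eps0.
near=> n.
rewrite sub0r normrN ger0_norm ?ip_ge0//.
apply: le_trans (ltW bm); apply: ip_psum_best => //.
by near: n; exists m.
Unshelve. all: by end_near. Qed.

(** Pairing with [e k] is continuous by Young's inequality, and constant along the partial sums once
    they contain the term of index [k]. *)
Lemma ip_cvg_eq f g a k : sqint f ->
  (forall l, ip f (e l) = a l) -> sqint g ->
  ip (fun x => g x - psum a n x) (fun x => g x - psum a n x) @[n --> \oo] --> 0 ->
  ip g (e k) = a k.
Proof.
move=> sf fa sg H; apply/eqP; rewrite -subr_eq0; apply/eqP.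
apply: (@small_norm_eq0 _ 1) => // eps eps0.
have eps20 : 0 < eps ^+ 2 by rewrite exprn_gt0.
(* The index [(n + k).+1] is beyond the threshold [n] and also includes the coefficient of index
   [k]. The accuracy [eps ^+ 2] pays for the weight [eps^-1] used next. *)
move/cvgrPdist_lt : H => /(_ _ eps20)[n _ /(_ (n + k).+1)/=].
move=> /(_ (leq_trans (leq_addr _ _) (leqnSn _))).
rewrite sub0r normrN ger0_norm ?ip_ge0// => nlt.
have sB : sqint (fun x => g x - psum a (n + k).+1 x).
  by apply: sqintB => //; exact: sqint_psum.
have := ip_young mD (_ : 0 < eps^-1) sB (se k); rewrite invr_gt0 => /(_ eps0).
rewrite ipBl//; last exact: sqint_psum.
rewrite ip_psum_e ltnS leq_addl oe eqxx invrK => /le_trans; apply.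
rewrite !mulr1 lerD2r -(ler_pM2l eps0) mulVKf ?gt_eqF// -expr2.
exact: ltW.
Qed.

(** [f] is orthogonal to every [psum], so [ip f h] only sees the approximation error of [h], which
    Young's inequality makes negligible. *)
Lemma ip_clspan_eq0 f h : sqint f -> (forall l, ip f (e l) = 0) -> clspan h ->
  ip f h = 0.
Proof.
move=> sf f0 [sh H]; apply: (@small_norm_eq0 _ (ip f f)); first exact: ip_ge0.
move=> eps eps0; have eps20 : 0 < eps ^+ 2 by rewrite exprn_gt0.
have [b [m bm]] := H _ eps20.
have sB : sqint (fun x => h x - psum b m x).
  by apply: sqintB => //; exact: sqint_psum.
have := ip_young mD eps0 sf sB.
rewrite ipBr//; last exact: sqint_psum.
rewrite [X in _ - X](ipC _ _ f) ip_psuml// big1 ?subr0; last first.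
  by move=> l _; rewrite ipC f0 mulr0.
move=> /le_trans; apply; rewrite lerD2l ler_pdivrMl// -expr2.
exact: ltW.
Qed.

End orthonormal_system.

(** * Trigonometric identities and the closed form of the kernel *)

Section trigonometry.
Variable R : realType.
Implicit Types x y z : R.

Definition freq (l : nat) : R := (4 * l + 1)%:R * pi / 2.

Lemma freqE l : freq l = (4 * l%:R + 1) * pi / 2.
Proof. by rewrite /freq natrD natrM. Qed.

Lemma sinMcos x y : 2 * (sin x * cos y) = sin (x + y) + sin (x - y).
Proof. by rewrite sinD sinB; ring. Qed.

Lemma cosMcos x y : 2 * (cos x * cos y) = cos (x + y) + cos (x - y).
Proof. by rewrite cosD cosB; ring. Qed.

Lemma sin_natmul_pi n : sin (n%:R * pi) = 0 :> R.
Proof.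
have := alternatingn (@sinDpi R) n 0.
by rewrite add0r sin0 mulr0 mulr_natl.
Qed.

(** The phase [freq l] is [l] full turns plus a quarter turn; this is where the index [4 * l + 1]
    matters. *)
Lemma sin_freq_cos l x : sin (freq l * (x + 1)) = cos (freq l * x).
Proof.
rewrite (_ : freq l * (x + 1) = (freq l * x + pi / 2) + pi *+ 2 *+ l).
  by rewrite (periodicn (@sinD2pi R)) sinDpihalf.
by rewrite -mulrnA -[pi *+ _]mulr_natl /freq natrD !natrM; field.
Qed.

(** Consecutive frequencies differ by [2 * pi], so twice each term on the left is [sin ((2 * l + 3 /
    2) * pi * z) - sin ((2 * l - 1 / 2) * pi * z)], and these telescope. *)
Lemma sum_cos_freq n z :
  sin (pi * z) * \sum_(l < n) cos (freq l * z) =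
  sin (n%:R * pi * z) * cos ((n%:R - 1 / 2) * pi * z).
Proof.
elim: n => [|n ih]; first by rewrite big_ord0 mulr0 !mul0r sin0 mul0r.
apply: (@mulfI _ 2); first by rewrite pnatr_eq0.
rewrite big_ord_recr/= mulrDr mulrDr ih !sinMcos.
rewrite -[in RHS]natr1 /freq natrD natrM.
set N := n%:R.
rewrite [X in sin X + sin _ + _](_ : _ = (2 * N - 1 / 2) * pi * z); last by field.
rewrite [X in _ + sin X + _](_ : _ = 1 / 2 * pi * z); last by field.
rewrite [X in _ + (sin X + _)](_ : _ = (2 * N + 3 / 2) * pi * z); last by field.
rewrite [X in _ + (_ + sin X)](_ : _ = - ((2 * N - 1 / 2) * pi * z)); last by field.
rewrite [X in _ = sin X + _](_ : _ = (2 * N + 3 / 2) * pi * z); last by field.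
rewrite [X in _ = _ + sin X](_ : _ = 1 / 2 * pi * z); last by field.
by rewrite sinN; ring.
Qed.

(** The shift [z + 1] in the kernel only produces a cosine and signs, which cancel. At [z = 0] the
    quotient is 0 by convention while the sum is [n.+1], hence the hypothesis. *)
Lemma Kker_sum n z : sin (pi * z) != 0 ->
  Kker n z = \sum_(l < n.+1) cos (freq l * z).
Proof.
move=> s0; apply: (mulfI s0); rewrite sum_cos_freq /Kker.
rewrite (_ : pi * (n%:R + 1 / 2) * (z + 1) =
    ((n%:R + 1 / 2) * pi * z + pi / 2) + pi *+ n); last first.
  by rewrite -[pi *+ n]mulr_natl; field.
rewrite (alternatingn (@sinDpi R)) sinDpihalf.
rewrite (_ : pi * (n%:R + 1) * (z + 1) = n.+1%:R * pi * z + pi *+ n.+1); last first.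
  by rewrite -[pi *+ _]mulr_natl -natr1; field.
rewrite (alternatingn (@sinDpi R)) exprS.
rewrite (_ : pi * (z + 1) = pi * z + pi); last by ring.
rewrite sinDpi (_ : n.+1%:R - 1 / 2 = n%:R + 1 / 2 :> R); last first.
  by rewrite -natr1; field.
have := sqrr_sign R n; rewrite expr2; set s := (-1) ^+ n => s2.
by rewrite -[RHS]mul1r -[X in _ = X * _]s2; field.
Qed.

(** The range is that of [x - y] for [x] and [y] in I. *)
Lemma sin_pi_eq0 z : -2 < z < 2 -> sin (pi * z) = 0 ->
  [\/ z = 0, z = 1 | z = -1].
Proof.
have pi0 := pi_gt0 R.
have pos (t : R) : 0 < t < 1 -> sin (pi * t) != 0.
  move=> /andP[t0 t1]; rewrite gt_eqF// sin_gt0_pi// mulr_gt0//=.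
  by rewrite -[X in _ < X]mulr1 ltr_pM2l.
have pos2 (t : R) : 0 < t < 2 -> sin (pi * t) = 0 -> t = 1.
  move=> /andP[t0 t2] /eqP st; have [t1|t1|//] := ltgtP t 1.
    by rewrite (negbTE (pos t _)) ?t0 in st.
  move: st; rewrite (_ : pi * t = pi * (t - 1) + pi); last by ring.
  by rewrite sinDpi oppr_eq0 (negbTE (pos _ _))//; apply/andP; split; lra.
move=> /andP[z1 z2] sz.
have [z0|z0|->] := ltgtP z 0; last by apply: Or31.
  apply: Or33; apply: oppr_inj; rewrite opprK.
  apply: pos2; first by apply/andP; split; lra.
  by rewrite mulrN sinN sz oppr0.
by apply: Or32; apply: pos2 => //; rewrite z0.
Qed.

End trigonometry.

(** * Real L^2 on I: reflection and orthonormality of the cosines *)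

Section real_L2_on_I.
Variable R : realType.
Local Notation mu := (@lebesgue_measure R).
Local Notation I := (@itvI R).
Local Notation sqintI := (@sqint _ _ R mu I).
Local Notation ipI := (@ip _ _ R mu I).
Implicit Types (f g : R -> R) (x y : R).

Lemma measurable_itvI : measurable (I : set (measurableTypeR R)).
Proof. exact: measurable_itv. Qed.
Local Hint Resolve measurable_itvI : core.

Lemma mu_itvI : mu I = 2%:E.
Proof. by rewrite lebesgue_measure_itv/= lte_fin ifT; [congr EFin|]; lra. Qed.

Lemma mu_itvI_fin : (mu I < +oo)%E.
Proof. by rewrite mu_itvI ltry. Qed.
Local Hint Resolve mu_itvI_fin : core.

Lemma oppr_itvI : -%R @^-1` I = I.
Proof.
by apply/seteqP; split => x; rewrite /itvI /preimage/= !in_itv/= => /andP[? ?];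
  apply/andP; split; lra.
Qed.

Lemma continuous_sqintI f M : continuous f -> (forall x, `|f x| <= M) ->
  sqintI f.
Proof.
move=> cf fM; apply: (@sqint_bounded _ _ _ mu I _ _ _ M) => //.
by apply: measurable_funTS; exact: continuous_measurable_fun.
Qed.

Lemma continuous_linear_comp f c : continuous f -> continuous (fun x => f (c * x)).
Proof.
move=> cf x; apply: (@continuous_comp _ _ _ ( *%R c) f); last exact: cf.
exact: mulrl_continuous.
Qed.

Lemma sqintI_cos c : sqintI (fun x => cos (c * x)).
Proof.
apply: (@continuous_sqintI _ 1); last by move=> x; exact: cos_max.
by apply: continuous_linear_comp; exact: continuous_cos.
Qed.

Lemma sqintI_sin c : sqintI (fun x => sin (c * x)).
Proof.
apply: (@continuous_sqintI _ 1); last by move=> x; exact: sin_max.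
by apply: continuous_linear_comp; exact: continuous_sin.
Qed.

(** Reflection invariance of Lebesgue measure, in the form that change of variables along a
    pushforward consumes. *)
Lemma pushforward_opp_itvI (F : R -> \bar R) :
  (\int[mu]_(x in I) F x =
   \int[pushforward mu (-%R : _ -> measurableTypeR R)]_(x in I) F x)%E.
Proof.
by apply: eq_measure_integral => A mA _; exact/esym/lebesgue_measureN.
Qed.

Lemma measurable_fun_opp f : measurable_fun I f -> measurable_fun I (f \o -%R).
Proof.
move=> mf; apply: (measurable_comp measurable_itvI _ mf) => //.
by rewrite -[X in _ `<=` X]oppr_itvI => _ [x Ix <-] /=; rewrite opprK.
Qed.

Lemma sqintI_opp f : sqintI f -> sqintI (f \o -%R).
Proof.
move=> sf; apply/sqintP => //; split.
  by apply: measurable_fun_opp; case: sf.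
have -> : (\int[mu]_(x in I) ((f \o -%R) x ^+ 2)%:E =
    \int[mu]_(x in I) (f x ^+ 2)%:E)%E.
  rewrite [RHS]pushforward_opp_itvI ge0_integral_pushforward//.
  - by rewrite oppr_itvI.
  - by apply/measurable_EFinP; apply: measurable_funX; case: sf.
  - by move=> y _; rewrite lee_fin sqr_ge0.
by have [] := (sqintP mu measurable_itvI f).1 sf.
Qed.

Lemma Rintegral_opp f : mu.-integrable I (EFin \o f) ->
  \int[mu]_(x in I) f (- x) = \int[mu]_(x in I) f x.
Proof.
move=> intf; have mf := measurable_int _ intf.
rewrite /Rintegral; congr fine.
rewrite [LHS]integralE [RHS]integralE; congr (_ - _)%E.
  rewrite [RHS]pushforward_opp_itvI ge0_integral_pushforward//.
    rewrite oppr_itvI; apply: eq_integral => x _.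
    by rewrite /= !funeposE.
  exact: measurable_funepos.
rewrite [RHS]pushforward_opp_itvI ge0_integral_pushforward//.
  rewrite oppr_itvI; apply: eq_integral => x _.
  by rewrite /= !funenegE.
exact: measurable_funeneg.
Qed.

Lemma ipI_opp f g : sqintI f -> sqintI g ->
  ipI (f \o -%R) (g \o -%R) = ipI f g.
Proof.
move=> sf sg.
by apply: (@Rintegral_opp (fun x => f x * g x)); exact: sqintM.
Qed.

(** The primitive [c^-1 * sin (c * x)] vanishes at both endpoints. *)
Lemma Rintegral_cos (c : R) : c != 0 -> sin c = 0 ->
  \int[mu]_(x in I) cos (c * x) = 0.
Proof.
move=> c0 sc.
pose F x := c^-1 * sin (c * x).
have dF x : is_derive x 1 F (cos (c * x)).
  rewrite /F; apply: is_derive_eq.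
  by rewrite /GRing.scale/=; field.
have cF : continuous F.
  by move=> x; apply: differentiable_continuous; apply/derivable1_diffP.
rewrite /Rintegral -(@integral_itv_bndoo _ _ _ _ true false); last first.
  by apply/measurable_EFinP; case: (sqintI_cos c).
rewrite (@continuous_FTC2 _ _ F)//.
- by rewrite /F mulr1 mulrN1 sinN sc oppr0 mulr0/= subrr.
- by apply: continuous_subspaceT; apply: continuous_linear_comp;
    exact: continuous_cos.
- split.
  + by move=> x _.
  + by apply: cvg_at_right_filter; exact: cF.
  + by apply: cvg_at_left_filter; exact: cF.
- by move=> x _; rewrite derive1E derive_val.
Qed.

Definition evec (l : nat) (x : R) : R := sin (freq R l * (x + 1)).

Lemma evecE l x : evec l x = cos (freq R l * x).
Proof. exact: sin_freq_cos. Qed.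

Lemma sqintI_evec l : sqintI (evec l).
Proof. by rewrite (funext (evecE l)); exact: sqintI_cos. Qed.

(** By product-to-sum, the frequencies become an odd multiple of [pi] and [(k - l) * 2 * pi]. Both
    cosines integrate to zero, except that for [k = l] the second is 1 and gives 2, the length of I;
    halving yields norm 1. *)
Lemma evec_orthonormal k l : ipI (evec k) (evec l) = (k == l)%:R.
Proof.
have icos c : mu.-integrable I (EFin \o (fun x => cos (c * x))).
  have := sqintM measurable_itvI (sqintI_cos c) (sqintI_cos 0).
  by under [X in EFin \o X]eq_fun do rewrite mul0r cos0 mulr1.
apply: (@mulfI _ 2); first by rewrite pnatr_eq0.
rewrite /ip -RintegralZl//; last exact: sqintM (sqintI_evec _) (sqintI_evec _).
under eq_Rintegral => x _.
  rewrite !evecE cosMcos -mulrDl -mulrBl.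
  over.
rewrite RintegralD// [X in X + _]Rintegral_cos.
- rewrite add0r; have [->|kl] := eqVneq k l.
    rewrite subrr; under eq_Rintegral do rewrite mul0r cos0.
    rewrite (_ : _ * _ = 1 * fine (mu I)); last first.
      by rewrite mu_itvI/= ?eqxx mulr1 mul1r.
    exact: Rintegral_cst.
  rewrite mulr0; have fE : freq R k - freq R l = (k%:R - l%:R) * (2 * pi).
    by rewrite !freqE; field.
  apply: Rintegral_cos; rewrite fE.
    apply: mulf_neq0; first by rewrite subr_eq0 eqr_nat.
    by rewrite gt_eqF// mulr_gt0 ?pi_gt0.
  (* With [l <= k] the difference is a natural number; oddness of the sine covers the other case. *)
  wlog lk : k l {kl fE} / (l <= k)%N => [H|].
    have [|/ltnW] := leqP l k; first exact: H.
    by move/H/eqP; rewrite -opprB mulNr sinN oppr_eq0 => /eqP.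
  by rewrite -natrB// mulrA -natrM sin_natmul_pi.
- by rewrite gt_eqF// addr_gt0// /freq divr_gt0// mulr_gt0// ?pi_gt0// ltr0n addn1.
- rewrite (_ : _ + _ = (2 * (k + l) + 1)%:R * pi) ?sin_natmul_pi//.
  by rewrite !freqE natrD natrM natrD; field.
Qed.

End real_L2_on_I.

(** * Convolution with the kernel, for real functions *)

Section real_convolution.
Variable R : realType.
Local Notation mu := (@lebesgue_measure R).
Local Notation I := (@itvI R).
Local Notation sqintI := (@sqint _ _ R mu I).
Local Notation ipI := (@ip _ _ R mu I).
Implicit Types (f g a : R -> R) (x y : R).

Local Hint Resolve measurable_itvI : core.

(** Points are null. Measurability off the three points suffices, as adding a point preserves it; so
    the kernel need only be compared with the cosine sum away from its singularities. *)
Lemma integral_setD3 (f : R -> R) (r s t : R) :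
  measurable_fun (I `\ r `\ s `\ t) f ->
  (\int[mu]_(y in I `\ r `\ s `\ t) (f y)%:E = \int[mu]_(y in I) (f y)%:E)%E.
Proof.
have mD (D : set (measurableTypeR R)) q : measurable D -> measurable (D `\ q).
  by move=> ?; apply: measurableD.
have mf1 (D : set R) q : measurable (D : set (measurableTypeR R)) ->
    measurable_fun (D `\ q) f -> measurable_fun D f.
  move=> mD'; have [Dq|nDq] := pselect (D q); last by rewrite not_setD1.
  move=> mf; rewrite -(@setD1K _ q D)//.
  by apply/measurable_funU => //; [exact: mD|split => //; exact: measurable_fun_set1].
move=> mf.
have mf2 : measurable_fun (I `\ r `\ s) f by apply: mf1 mf; do 2 apply: (mD).
have mf3 : measurable_fun (I `\ r) f by apply: mf1 mf2; exact: mD.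
rewrite integral_setD1; [|by do 3 apply: (mD)|exact/measurable_EFinP].
rewrite integral_setD1; [|by do 2 apply: (mD)|exact/measurable_EFinP].
by rewrite integral_setD1; [|exact: mD|exact/measurable_EFinP].
Qed.

Lemma even_part_cos a c : sqintI a ->
  ipI (fun y => cos (c * y)) (fun y => 1 / 2 * (a y + a (- y))) =
  ipI a (fun y => cos (c * y)).
Proof.
move=> sa; have so := sqintI_opp sa; have sc := sqintI_cos c.
rewrite ipZr//; last exact: (sqintD _ sa so).
rewrite (ipDr _ sa so)//.
have -> : ipI (fun y => cos (c * y)) (a \o -%R) = ipI (fun y => cos (c * y)) a.
  rewrite -[RHS]ipI_opp//; congr ip.
  by apply/funext => y /=; rewrite mulrN cosN.
by rewrite [RHS]ipC; field.
Qed.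

Lemma even_part_sin a c : sqintI a ->
  ipI (fun y => sin (c * y)) (fun y => 1 / 2 * (a y + a (- y))) = 0.
Proof.
move=> sa; have so := sqintI_opp sa; have sc := sqintI_sin c.
rewrite ipZr//; last exact: (sqintD _ sa so).
rewrite (ipDr _ sa so)//.
have -> : ipI (fun y => sin (c * y)) (a \o -%R) =
    - ipI (fun y => sin (c * y)) a.
  rewrite -[in RHS]ipI_opp// -mulN1r -ipZl//; [|exact: sqintI_opp..].
  congr ip.
  by apply/funext => y /=; rewrite mulrN sinN mulN1r opprK.
by rewrite subrr mulr0.
Qed.

Lemma convol_Kker_psum n x a : I x -> sqintI a ->
  \int[mu]_(y in I) (Kker n (x - y) * (1 / 2 * (a y + a (- y)))) =
  psum (@evec R) (fun l => ipI a (evec l)) n.+1 x.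
Proof.
move=> Ix sa; pose w y := 1 / 2 * (a y + a (- y)).
have sw : sqintI w by apply: sqintZ => //; apply: (sqintD _ sa (sqintI_opp sa)).
(* The expansion of [cos (freq R l * (x - y))]; against the even [w] only the first product
   survives. *)
pose k l y := cos (freq R l * x) * cos (freq R l * y)
  + sin (freq R l * x) * sin (freq R l * y).
have sk l : sqintI (k l).
  by apply: sqintD => //; apply: sqintZ => //; [exact: sqintI_cos|exact: sqintI_sin].
transitivity (ipI (fun y => \sum_(l < n.+1) k l y) w).
  have := @sqint_sum _ _ _ mu I (@measurable_itvI R) _ (index_enum 'I_n.+1)
    (fun l => k l) (fun l => sk l).
  move=> ss; have mg : measurable_fun I (fun y => (\sum_(l < n.+1) k l y) * w y).
    by have /measurable_int/measurable_EFinP := sqintM (@measurable_itvI R) ss sw.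
  (* The removed points are those where [x - y] is 0, 1 or -1. *)
  pose D := I `\ x `\ (x - 1) `\ (x + 1).
  have eqD y : D y -> Kker n (x - y) * w y = (\sum_(l < n.+1) k l y) * w y.
    move=> [[[Iy /eqP yx] /eqP yx1] /eqP yx2].
    rewrite Kker_sum; last first.
      apply/eqP => /sin_pi_eq0; have := Ix; have := Iy.
      rewrite /itvI/= !in_itv/= => /andP[? ?] /andP[? ?].
      case=> [|/eqP|/eqP|/eqP]; first by apply/andP; split; lra.
      - by rewrite subr_eq0 eq_sym (negbTE yx).
      - by move: yx1; rewrite -subr_eq0 => ?; lra.
      - by move=> ?; lra.
    congr (_ * _); apply: eq_bigr => l _.
    by rewrite /k mulrBr cosB.
  have mD : measurable_fun D (fun y => (\sum_(l < n.+1) k l y) * w y).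
    by apply: (measurable_funS (@measurable_itvI R) _ mg) => y [[[]]].
  rewrite /ip /Rintegral; congr fine.
  rewrite -[RHS](@integral_setD3 _ x (x - 1) (x + 1))//.
  rewrite -(@integral_setD3 _ x (x - 1) (x + 1)).
    by apply: eq_integral => y; rewrite inE => /eqD ->.
  by apply: eq_measurable_fun mD => y; rewrite inE => /eqD ->.
rewrite ip_suml//; apply: eq_bigr => l _.
rewrite ipDl//; [|by apply: sqintZ => //; exact: sqintI_cos
                 |by apply: sqintZ => //; exact: sqintI_sin].
rewrite !ipZl//; [|exact: sqintI_sin|exact: sqintI_cos].
rewrite even_part_cos// even_part_sin// mulr0 addr0.
by rewrite (funext (evecE l)) mulrC.
Qed.

End real_convolution.

(** * Complex L^2 through real and imaginary parts *)

Section complex_L2.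
Variable R : realType.
Local Notation mu := (@lebesgue_measure R).
Local Notation I := (@itvI R).
Local Notation sqintI := (@sqint _ _ R mu I).
Local Notation ipI := (@ip _ _ R mu I).
Local Notation Re := (@complex.Re R).
Local Notation Im := (@complex.Im R).
Implicit Types (f g u m p : R -> R[i]) (z w : R[i]).

Local Hint Resolve measurable_itvI : core.

Lemma ReB z w : Re (z - w) = Re z - Re w.
Proof. by case: z; case: w. Qed.

Lemma ImB z w : Im (z - w) = Im z - Im w.
Proof. by case: z; case: w. Qed.

Lemma ReM_real z (r : R) : Re (z * r%:C%C) = Re z * r.
Proof. by case: z => a b /=; rewrite mulr0 subr0. Qed.

Lemma ImM_real z (r : R) : Im (z * r%:C%C) = Im z * r.
Proof. by case: z => a b /=; rewrite mulr0 add0r. Qed.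

Lemma Re_sum (J : finType) (F : J -> R[i]) : Re (\sum_j F j) = \sum_j Re (F j).
Proof. by apply: (big_morph Re _ (erefl _)) => -[a b] [c d]. Qed.

Lemma Im_sum (J : finType) (F : J -> R[i]) : Im (\sum_j F j) = \sum_j Im (F j).
Proof. by apply: (big_morph Im _ (erefl _)) => -[a b] [c d]. Qed.

Lemma L2normE f : (L2norm f =
  (\int[mu]_(x in I) (Re (f x) ^+ 2 + Im (f x) ^+ 2)%:E) `^ 2^-1)%E.
Proof.
rewrite /L2norm unlock; congr (_ `^ _)%E.
rewrite [RHS]integral_mkcond; apply: eq_integral => x _.
rewrite /patch; case: ifPn => _; last first.
  by rewrite abse0 poweR0r ?pnatr_eq0.
rewrite -[abse _]/(_%:E) poweR_EFin; congr EFin.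
rewrite powR_mulrn ?normr_ge0// real_normK ?num_real//.
by case: (f x) => a b /=; rewrite sqr_sqrtr// addr_ge0// sqr_ge0.
Qed.

Lemma integral_sqr_Re_Im f : sqintI (Re \o f) -> sqintI (Im \o f) ->
  (\int[mu]_(x in I) (Re (f x) ^+ 2 + Im (f x) ^+ 2)%:E =
   (ipI (Re \o f) (Re \o f) + ipI (Im \o f) (Im \o f))%:E)%E.
Proof.
move=> sr si; rewrite EFinD -!integral_sqrE//.
have msqr h : sqintI h -> measurable_fun I (fun x => (h x ^+ 2)%:E).
  by case=> mh _; apply/measurable_EFinP; exact: measurable_funX.
rewrite -ge0_integralD//; do ?exact: msqr; do ?by move=> x _; rewrite lee_fin sqr_ge0.
Qed.

Lemma inL2P f : inL2 f <-> sqintI (Re \o f) /\ sqintI (Im \o f).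
Proof.
split=> [[mr mi foo]|[sr si]].
  have msqr (h : measurableTypeR R -> R) : measurable_fun I h ->
      measurable_fun I (fun x => (h x ^+ 2)%:E).
    by move=> mh; apply/measurable_EFinP; exact: measurable_funX.
  have : (\int[mu]_(x in I) (Re (f x) ^+ 2 + Im (f x) ^+ 2)%:E < +oo)%E.
    move: foo; rewrite L2normE; apply: contraTT; rewrite -!leNgt !leye_eq => /eqP ->.
    by rewrite poweRyr ?invr_eq0 ?pnatr_eq0.
  under eq_integral do rewrite EFinD.
  rewrite ge0_integralD//; do ?exact: msqr; do ?by move=> x _; rewrite lee_fin sqr_ge0.
  move=> H; split; apply/sqintP => //; split => //; apply: le_lt_trans H.
    by rewrite leeDl// integral_ge0// => x _; rewrite lee_fin sqr_ge0.
  by rewrite leeDr// integral_ge0// => x _; rewrite lee_fin sqr_ge0.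
split; [by case: sr|by case: si|].
by rewrite L2normE integral_sqr_Re_Im// poweR_EFin ltry.
Qed.

Lemma L2norm_sqrt f : inL2 f -> (L2norm f = (Num.sqrt
  (ipI (Re \o f) (Re \o f) + ipI (Im \o f) (Im \o f)))%:E)%E.
Proof.
move=> /inL2P[sr si].
rewrite L2normE integral_sqr_Re_Im// poweR_EFin powR12_sqrt//.
by rewrite addr_ge0// ip_ge0.
Qed.

Lemma eq_L2norm f g : (forall x, I x -> f x = g x) -> L2norm f = L2norm g.
Proof.
by move=> fg; rewrite !L2normE; congr (_ `^ _)%E; apply: eq_integral => x;
  rewrite inE => /fg ->.
Qed.

(** Needed because the convolution is identified with a partial sum only at points of I. *)
Lemma eq_inL2 f g : (forall x, I x -> f x = g x) -> inL2 f -> inL2 g.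
Proof.
move=> fg [mr mi foo]; split; last by rewrite -(eq_L2norm fg).
- by apply: eq_measurable_fun mr => x; rewrite inE => /fg ->.
- by apply: eq_measurable_fun mi => x; rewrite inE => /fg ->.
Qed.

Lemma inL2B f g : inL2 f -> inL2 g -> inL2 (f \- g).
Proof.
move=> /inL2P[fr fi] /inL2P[gr gi]; apply/inL2P; split.
  rewrite (_ : _ \o _ = (fun x => (Re \o f) x - (Re \o g) x)).
    exact: sqintB.
  by apply/funext => x /=; rewrite ReB.
rewrite (_ : _ \o _ = (fun x => (Im \o f) x - (Im \o g) x)).
  exact: sqintB.
by apply/funext => x /=; rewrite ImB.
Qed.

Lemma L2inner_ip f g : inL2 f -> inL2 g -> L2inner f g =
  ((ipI (Re \o f) (Re \o g) + ipI (Im \o f) (Im \o g))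
   +i* (ipI (Im \o f) (Re \o g) - ipI (Re \o f) (Im \o g)))%C.
Proof.
move=> /inL2P[fr fi] /inL2P[gr gi]; rewrite /L2inner /cintegral /ip.
have iM := sqintM (@measurable_itvI R).
rewrite -RintegralD//; do ?exact: iM.
rewrite -RintegralB//; do ?exact: iM.
congr (_ +i* _)%C; apply: eq_Rintegral => x _ /=;
  case: (f x) => a b; case: (g x) => c d /=; ring.
Qed.

Lemma L2norm_cvg0 (v : nat -> R -> R[i]) : (forall n, inL2 (v n)) ->
  ipI (Re \o v n) (Re \o v n) @[n --> \oo] --> 0 ->
  ipI (Im \o v n) (Im \o v n) @[n --> \oo] --> 0 ->
  L2norm (v n) @[n --> \oo] --> 0%E.
Proof.
move=> sv r0 i0; under eq_cvg do rewrite L2norm_sqrt//.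
apply: cvg_EFin; first exact: nearW.
rewrite -[0 : R]sqrtr0; apply: continuous_cvg; first exact: sqrt_continuous.
by rewrite -[0 : R]addr0; exact: cvgD.
Qed.

End complex_L2.

(** * The closed span, existence of the projection, and its coefficients *)

Section projection.
Variable R : realType.
Local Notation mu := (@lebesgue_measure R).
Local Notation I := (@itvI R).
Local Notation sqintI := (@sqint _ _ R mu I).
Local Notation ipI := (@ip _ _ R mu I).
Local Notation Re := (@complex.Re R).
Local Notation Im := (@complex.Im R).
Local Notation psumI := (psum (@evec R)).
Local Notation clspanI := (clspan mu I (@evec R)).
Local Notation esins := [set @esin R (4 * l + 1)%N | l in [set: nat]].
Local Notation M := (L2closure (cspan esins)).
Implicit Types (f g u p : R -> R[i]) (a b : nat -> R).

Local Hint Resolve measurable_itvI mu_itvI_fin sqintI_evec evec_orthonormal : core.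

Definition cpsum a b n (x : R) : R[i] := (psumI a n x +i* psumI b n x)%C.

Lemma esinE l (x : R) : esin (4 * l + 1) x = (evec l x)%:C%C.
Proof. by []. Qed.

Lemma inL2_cpsum a b n : inL2 (cpsum a b n).
Proof. by apply/inL2P; split; exact: sqint_psum. Qed.

Lemma cpsum_cspan a b n : cspan esins (cpsum a b n).
Proof.
exists n, (fun l => (a l +i* b l)%C), (fun l => esin (4 * l + 1)%N).
split=> [l|x]; first by exists (l : nat).
apply/eqP; rewrite eq_complex Re_sum Im_sum; apply/andP; split; apply/eqP;
  by rewrite [LHS]/= /psum; apply: eq_bigr => l _;
    rewrite esinE ?ReM_real ?ImM_real.
Qed.

(** An arbitrary combination may repeat or skip indices: coefficients are collected over each fibre
    of [L], an empty fibre giving 0, up to the largest index. *)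
Lemma cspan_cpsum f : cspan esins f -> exists a b n, f = cpsum a b n.
Proof.
move=> [m [c [g [gE fE]]]].
have [L LE] : exists L : 'I_m -> nat, forall i, g i = esin (4 * L i + 1)%N.
  have /choice[L LE] : forall i, exists l, g i = esin (4 * l + 1)%N.
    by move=> i; have [l _ <-] := gE i; exists l.
  by exists L.
pose n := (\max_i L i).+1.
have Ln i : (L i < n)%N by rewrite ltnS; exact: leq_bigmax.
have psumE (r : 'I_m -> R) x : \sum_i r i * evec (L i) x =
    psumI (fun l => \sum_(i | L i == l) r i) n x.
  rewrite (partition_big (fun i => Ordinal (Ln i)) xpredT)//=.
  by apply: eq_bigr => l _; rewrite mulr_suml; apply: eq_bigr => i /eqP <-.
exists (fun l => \sum_(i | L i == l) Re (c i)),
  (fun l => \sum_(i | L i == l) Im (c i)), n.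
apply/funext => x; rewrite fE /cpsum -!psumE.
apply/eqP; rewrite eq_complex Re_sum Im_sum; apply/andP; split; apply/eqP;
  by apply: eq_bigr => i _; rewrite LE esinE ?ReM_real ?ImM_real.
Qed.

Lemma L2norm_subC f g : L2norm (f \- g) = L2norm (g \- f).
Proof.
rewrite !L2normE; congr (_ `^ _)%E; apply: eq_integral => x _ /=.
by rewrite !ReB !ImB; congr EFin; ring.
Qed.

Lemma ip_sqr_sub f a b n : inL2 f ->
  ipI (Re \o (f \- cpsum a b n)) (Re \o (f \- cpsum a b n)) =
    ipI (fun x => Re (f x) - psumI a n x) (fun x => Re (f x) - psumI a n x) /\
  ipI (Im \o (f \- cpsum a b n)) (Im \o (f \- cpsum a b n)) =
    ipI (fun x => Im (f x) - psumI b n x) (fun x => Im (f x) - psumI b n x).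
Proof. by split; apply: eq_Rintegral => x _ /=; rewrite ?ReB ?ImB. Qed.

Lemma cpsum_cvg f a b : inL2 f ->
  ipI (fun x => Re (f x) - psumI a n x)
      (fun x => Re (f x) - psumI a n x) @[n --> \oo] --> 0 ->
  ipI (fun x => Im (f x) - psumI b n x)
      (fun x => Im (f x) - psumI b n x) @[n --> \oo] --> 0 ->
  L2norm (f \- cpsum a b n) @[n --> \oo] --> 0%E.
Proof.
move=> sf r0 i0; apply: L2norm_cvg0.
- by move=> n; apply: inL2B => //; exact: inL2_cpsum.
- by under eq_cvg do rewrite (ip_sqr_sub _ _ _ sf).1.
- by under eq_cvg do rewrite (ip_sqr_sub _ _ _ sf).2.
Qed.

Lemma closure_clspan f : M f -> clspanI (Re \o f) /\ clspanI (Im \o f).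
Proof.
move=> [sf H]; have [sr si] := (inL2P f).1 sf.
have {}H eps : 0 < eps -> exists a b n,
    ipI (fun x => Re (f x) - psumI a n x) (fun x => Re (f x) - psumI a n x) +
    ipI (fun x => Im (f x) - psumI b n x) (fun x => Im (f x) - psumI b n x) < eps.
  (* [L2closure] bounds the norm and [clspan] its square, hence the radius [Num.sqrt eps]. *)
  move=> e0; have se0 : 0 < Num.sqrt eps by rewrite sqrtr_gt0.
  have [_ [/cspan_cpsum[a [b [n ->]]] sg lt]] := H _ se0.
  exists a, b, n; move: lt.
  rewrite L2norm_sqrt; last exact: inL2B.
  have [-> ->] := ip_sqr_sub a b n sf.
  by rewrite lte_fin ltr_sqrt.
split; split => // eps /H[a [b [n lt]]]; [exists a, n|exists b, n];
  apply: le_lt_trans lt; rewrite ?lerDl ?lerDr; exact: ip_ge0.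
Qed.

Lemma esin_closure l : M (esin (4 * l + 1)%N).
Proof.
have sE : inL2 (esin (4 * l + 1)%N : R -> R[i]).
  apply/inL2P; split; first exact: sqintI_evec.
  exact: sqint0.
split => // eps e0; exists (esin (4 * l + 1)%N); split => //.
  exists 1%N, (fun=> 1), (fun=> esin (4 * l + 1)%N); split => [_|x].
    by exists l.
  by rewrite big_ord1 mul1r.
rewrite L2norm_sqrt; last exact: inL2B.
rewrite (_ : _ + _ = 0) ?sqrtr0 ?lte_fin//.
rewrite (_ : Re \o _ = cst 0); last by apply/funext => x /=; rewrite subrr.
rewrite (_ : Im \o _ = cst 0); last by apply/funext => x /=; rewrite subrr.
by rewrite ip0l// addr0.
Qed.

Lemma projection_exists u : inL2 u -> exists p, is_orthogonal_projection M u p.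
Proof.
move=> su; have [sr si] := (inL2P u).1 su.
have [g1 [s1 c1]] := riesz_fischer (@measurable_itvI R) (mu_itvI_fin R)
  (@sqintI_evec R) (@evec_orthonormal R) sr.
have [g2 [s2 c2]] := riesz_fischer (@measurable_itvI R) (mu_itvI_fin R)
  (@sqintI_evec R) (@evec_orthonormal R) si.
pose p x := (g1 x +i* g2 x)%C.
have sp : inL2 p by apply/inL2P.
exists p; split.
  split => // eps e0.
  have /fine_cvgP[_ /cvgrPdist_lt/(_ _ e0)] := cpsum_cvg sp c1 c2.
  move=> [n _ /(_ n (leqnn n))/=].
  set a := fun l => ipI (Re \o u) _; set b := fun l => ipI (Im \o u) _.
  have sd : inL2 (p \- cpsum a b n) by apply: inL2B => //; exact: inL2_cpsum.
  rewrite L2norm_sqrt// sub0r normrN/= => /(le_lt_trans (ler_norm _)) lt.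
  exists (cpsum a b n); split; [exact: cpsum_cspan|exact: inL2_cpsum|].
  by rewrite L2norm_sqrt.
move=> m Mm; have [sm _] := Mm; have [mr mi] := closure_clspan Mm.
have sd := inL2B su sp; have [dr di] := (inL2P _).1 sd.
rewrite L2inner_ip//.
(* [p] has the coefficients of [u] by [ip_cvg_eq]. Passing to the closed span then kills all four
   real products that make up the complex inner product with [m]. *)
have r0 l : ipI (Re \o (u \- p)) (evec l) = 0.
  rewrite (_ : Re \o _ = (fun x => (Re \o u) x - g1 x)); last first.
    by apply/funext => x /=; rewrite ReB.
  rewrite ipBl// (ip_cvg_eq _ _ _ _ sr _ s1 c1)// subrr//.
have i0 l : ipI (Im \o (u \- p)) (evec l) = 0.
  rewrite (_ : Im \o _ = (fun x => (Im \o u) x - g2 x)); last first.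
    by apply/funext => x /=; rewrite ImB.
  rewrite ipBl// (ip_cvg_eq _ _ _ _ si _ s2 c2)// subrr//.
have ort := ip_clspan_eq0 (@measurable_itvI R) (@sqintI_evec R).
by rewrite !ort// addr0 subrr.
Qed.

(** [esin (4 * l + 1)] is real-valued, so the two parts of the vanishing inner product give the two
    equalities. Nothing is assumed on how [p] was obtained. *)
Lemma projection_coef u p l : inL2 u -> is_orthogonal_projection M u p ->
  ipI (Re \o p) (evec l) = ipI (Re \o u) (evec l) /\
  ipI (Im \o p) (evec l) = ipI (Im \o u) (evec l).
Proof.
move=> su [[sp _] ort]; have [se _] := esin_closure l.
have := ort _ (esin_closure l); rewrite L2inner_ip//; last exact: inL2B.
have -> : Re \o esin (4 * l + 1)%N = evec l by [].
have -> : Im \o esin (4 * l + 1)%N = cst 0 :> (R -> R) by [].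
rewrite ![ipI _ (cst 0)]ipC !ip0l// addr0 subr0 => -[rE iE].
have [ur ui] := (inL2P u).1 su; have [pr pi] := (inL2P p).1 sp.
split; apply/esym/eqP; rewrite -subr_eq0 -ipBl//; apply/eqP.
  by rewrite -[RHS]rE; apply: eq_Rintegral => x _ /=; rewrite ReB.
by rewrite -[RHS]iE; apply: eq_Rintegral => x _ /=; rewrite ImB.
Qed.

Lemma convol_cpsum n u x : inL2 u -> I x ->
  convol (Kker n) (fun y => 1 / 2 * (u y + u (- y))) x =
  cpsum (fun l => ipI (Re \o u) (evec l)) (fun l => ipI (Im \o u) (evec l)) n.+1 x.
Proof.
move=> /inL2P[ur ui] Ix; rewrite /convol /cintegral /cpsum.
rewrite -!convol_Kker_psum//.
(* As an embedded real, the complex scalar acts on real and imaginary parts separately. *)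
have half : 1 / 2 = (1 / 2 : R)%:C%C :> R[i].
  by rewrite rmorphM/= fmorphV rmorph1 rmorph_nat.
congr (_ +i* _)%C; apply: eq_Rintegral => y _; rewrite half /=;
  case: (u y) (u (- y)) => [a b] [c d] /=; ring.
Qed.

End projection.

Theorem mainTheorem19 (R : realType) (u : R -> R[i]) (hu : inL2 u) :
  L2cvg (fun n : nat => convol (Kker n) (fun x => 1 / 2 * (u x + u (- x))))
        (orthogonal_projection
           (L2closure (cspan [set @esin R (4 * l + 1)%N | l in [set: nat]])) u).
Proof.
have [p0 p0P] := projection_exists hu.
set M := L2closure _; set p := orthogonal_projection M u.
(* Existence excludes the default value of [xget]; [p] may still differ from [p0]. *)
have pP : is_orthogonal_projection M u p by exact: (xgetI _ p0P).
have [Mp _] := pP; have [sp _] := Mp; have [pr pi] := closure_clspan Mp.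
set v := (X in L2cvg X).
pose a l := ip lebesgue_measure (@itvI R) (@complex.Re R \o u) (evec l).
pose b l := ip lebesgue_measure (@itvI R) (@complex.Im R \o u) (evec l).
have vE n x : itvI x -> v n x = cpsum a b n.+1 x by exact: convol_cpsum.
split => //.
  by move=> n; apply: (@eq_inL2 _ (cpsum a b n.+1)) => [x /vE ->//|]; exact: inL2_cpsum.
have -> : (fun n => L2norm (v n \- p)) = (fun n => L2norm (p \- cpsum a b n.+1)).
  apply/funext => n; rewrite L2norm_subC; apply: eq_L2norm => x Ix /=.
  by rewrite vE.
have aE : a = fun l => ip lebesgue_measure (@itvI R) (@complex.Re R \o p) (evec l).
  by apply/funext => l; rewrite (projection_coef _ hu pP).1.
have bE : b = fun l => ip lebesgue_measure (@itvI R) (@complex.Im R \o p) (evec l).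
  by apply/funext => l; rewrite (projection_coef _ hu pP).2.
(* [Kker n] has [n.+1] cosine terms; the shift does not affect the limit. *)
rewrite (cvg_shiftS (fun n => L2norm (p \- cpsum a b n))).
have cvg h := @clspan_psum_cvg _ _ _ lebesgue_measure _ (@measurable_itvI R) _
  (@sqintI_evec R) (@evec_orthonormal R) h.
by rewrite aE bE; apply: cpsum_cvg => //; exact: cvg.
Qed.
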